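(* There exists a family of multi energy games $(G(K))_{K\ge1}$, $G(K)=(S_1,S_2,s_{init},E,k=2K,w)$ with $w:E\to\{-1,0,1\}^k$, such that for any initial credit, $\mathcal P_1$ needs exponential memory to win. That is: the size of $G(K)$ is polynomial in $K$, $\mathcal P_1$ has a winning strategy in $G(K)$ for some initial credit, and there is a constant $a>0$ such that for all $K\ge1$ and all initial credits $v_0\in\mathbb N^k$, every finite-memory strategy of $\mathcal P_1$ that is winning in $G(K)$ for initial credit $v_0$ needs a Moore machine with at least $2^{ak}$ memory states.
   Context: A game $G=(S_1,S_2,s_{init},E,k,w)$ consists of finite disjoint sets $S_1,S_2$ of states of player 1 ($\mathcal P_1$) and player 2 ($\mathcal P_2$), $S=S_1\cup S_2$, $s_{init}\in S$, $E\subseteq S\times S$ such that every state has a successor, $k\in\mathbb N$, $w:E\to\mathbb Z^k$. A play is an infinite path $\pi=s_0s_1\dots$ with $s_0=s_{init}$; $\pi(n)=s_0\dots s_n$, $\mathsf{EL}(s_0\dots s_n)=\sum_{i<n}w(s_i,s_{i+1})$. A pure strategy of $\mathcal P_1$ maps finite prefixes ending in $S_1$ to a successor of the last state; it is finite-memory if encoded by a Moore machine $(M,m_0,\alpha_u:M\times S\to M,\alpha_n:M\times S_1\to S)$ with $M$ finite (in state $s$ with memory $m$ the strategy plays $\alpha_n(m,s)$; on leaving $s$ the memory becomes $\alpha_u(m,s)$). It is winning for initial credit $v_0\in\mathbb N^k$ if every consistent play satisfies $v_0+\mathsf{EL}(\pi(n))\in\mathbb N^k$ for all $n\ge0$. 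*)

(* Defs.v *)
From HB Require Import structures.
From mathcomp Require Import all_boot all_order all_algebra.

Set Implicit Arguments.
Unset Strict Implicit.
Unset Printing Implicit Defensive.

Import Order.TTheory GRing.Theory Num.Theory.

Local Open Scope ring_scope.

(* The disjoint union of the two players' states is a sum type.  The weight
   is total on pairs of states, but only its values on edges are ever used. *)
Record game := Game {
  S1 : finType;
  S2 : finType;
  s_init : S1 + S2;
  edge : rel (S1 + S2);
  edge_total : forall s, exists t, edge s t;
  game_dim : nat;
  weight : S1 + S2 -> S1 + S2 -> 'rV[int]_game_dim
}.

Definition state (G : game) : finType := (S1 G + S2 G)%type.

(* Size of an explicit listing of the states, the edges and, for each edge,
   the sign and the binary digits of each weight component; [trunc_log 2 n + 1]
   is the number of binary digits of [n]. *)
Definition game_size (G : game) : nat :=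
  (#|state G| +
   \sum_(e : state G * state G | edge e.1 e.2)
     (1 + \sum_(i < game_dim G) (trunc_log 2 `|weight e.1 e.2 0%R i| + 2)))%N.

Definition is_prefix (G : game) (rho : seq (state G)) : bool :=
  if rho is s :: p then (s == s_init G) && path (@edge G) s p else false.

Definition is_play (G : game) (pi : nat -> state G) : Prop :=
  pi 0%N = s_init G /\ forall n, edge (pi n) (pi n.+1).

Definition play_prefix (G : game) (pi : nat -> state G) (n : nat) :
  seq (state G) := mkseq pi n.+1.

Definition EL (G : game) (rho : seq (state G)) : 'rV[int]_(game_dim G) :=
  \sum_(e <- zip rho (behead rho)) weight e.1 e.2.

(* A strategy of player 1 is represented by a total function on sequences;
   only its values on prefixes of the game ending in [S1] matter. *)
Definition is_strategy (G : game) (sigma : seq (state G) -> state G) : Prop :=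
  forall (h : seq (state G)) (s : S1 G),
    is_prefix (rcons h (inl s)) -> edge (inl s) (sigma (rcons h (inl s))).

Definition consistent (G : game) (sigma : seq (state G) -> state G)
    (pi : nat -> state G) : Prop :=
  forall (n : nat) (s : S1 G),
    pi n = inl s -> pi n.+1 = sigma (play_prefix pi n).

Definition winning (G : game) (v0 : 'rV[nat]_(game_dim G))
    (sigma : seq (state G) -> state G) : Prop :=
  is_strategy sigma /\
  forall pi : nat -> state G, is_play pi -> consistent sigma pi ->
  forall (n : nat) (i : 'I_(game_dim G)),
    0 <= (v0 0 i)%:Z + EL (play_prefix pi n) 0 i.

Record moore (G : game) := Moore {
  memory : finType;
  m0 : memory;
  alpha_u : memory -> state G -> memory;
  alpha_n : memory -> S1 G -> state G
}.

(* The memory is updated when a state is left, so the last state of the prefix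
   has not been read yet when the next move is chosen. *)
Definition encodes (G : game) (A : moore G)
    (sigma : seq (state G) -> state G) : Prop :=
  forall (h : seq (state G)) (s : S1 G),
    is_prefix (rcons h (inl s)) ->
    sigma (rcons h (inl s)) = alpha_n (foldl (@alpha_u G A) (m0 A) h) s.

(* Main.v *)
(* In each round P2 chooses K bits and then P1 chooses K bits.  The i-th bit b
   of either player adds (-1)^b to dimension 2i and -(-1)^b to dimension 2i+1,
   so P1 wins by complementing P2's bits.  The K-bit answer of P1 in a round is
   determined by the memory at its start.  If some vector r is never an answer,
   P2 always plays the complement u of r: then every answer agrees with u in
   some coordinate, so the sum of the K energies that u decreases drops by at
   least 2 in every round.  Hence every r is an answer, and there are at least
   2^K memory states. *)
Require Import Defs.
From HB Require Import structures.
From mathcomp Require Import all_boot all_order all_algebra.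
From mathcomp Require Import reals exp.
From mathcomp Require Import zify.

Set Implicit Arguments.
Unset Strict Implicit.
Unset Printing Implicit Defensive.

Import Order.TTheory GRing.Theory Num.Theory.

Local Open Scope ring_scope.

(** * The game: rounds of [period n] moves, encoded by position and bit *)

(* Here K = n + 1.  P2 owns the positions 0 .. n+1 of a round, the last one being
   idle, and P1 the positions n+2 .. 2n+2.  A chosen bit is recorded in the
   target of the edge, while the dimension pair is read off its source. *)
Definition period (n : nat) : nat := (n.+2 + n.+1)%N.

Definition gstate (n : nat) : finType := ('I_n.+1 * bool + 'I_n.+2 * bool)%type.

Definition coord (n : nat) (s : gstate n) : nat :=
  match s with inl x => x.1 | inr x => x.1 end.

Definition bit (n : nat) (s : gstate n) : bool :=
  match s with inl x => x.2 | inr x => x.2 end.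

Definition pos (n : nat) (s : gstate n) : nat :=
  match s with inl x => n.+2 + x.1 | inr x => x.1 end.

Definition state_at (n p : nat) (b : bool) : gstate n :=
  if (p < n.+2)%N then inr (inord p, b) else inl (inord (p - n.+2), b).

Definition gedge (n : nat) : rel (gstate n) :=
  fun s t => pos t == ((pos s).+1 %% period n)%N.

Definition gweight (n : nat) (s t : gstate n) : 'rV[int]_(2 * n.+1) :=
  \row_c if c./2 == coord s then (-1) ^+ (odd c (+) bit t) else 0.

Lemma period_gt0 n : (0 < period n)%N.
Proof. by []. Qed.

Lemma pos_lt n (s : gstate n) : (pos s < period n)%N.
Proof. by case: s => -[i b] /=; rewrite /period; have := ltn_ord i; lia. Qed.

Lemma pos_state_at n p b : (p < period n)%N -> pos (state_at n p b) = p.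
Proof.
rewrite /state_at /period => lt_p; case: ltnP => /= h; rewrite inordK //; lia.
Qed.

Lemma bit_state_at n p b : bit (state_at n p b) = b.
Proof. by rewrite /state_at; case: ifP. Qed.

Lemma state_atK n (s : gstate n) : state_at n (pos s) (bit s) = s.
Proof.
rewrite /state_at; case: s => -[i b] /=.
  by rewrite ltnNge leq_addr /= addKn inord_val.
by rewrite ltn_ord inord_val.
Qed.

Lemma coordE n (s : gstate n) :
  coord s = if (pos s < n.+2)%N then pos s else (pos s - n.+2)%N.
Proof.
case: s => -[i b] /=; first by rewrite ltnNge leq_addr /= addKn.
by rewrite ltn_ord.
Qed.

Lemma gedge_state_at n (s : gstate n) b :
  gedge s (state_at n ((pos s).+1 %% period n)%N b).
Proof. by rewrite /gedge pos_state_at // ltn_mod. Qed.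

Lemma gedge_total n (s : gstate n) : exists t, gedge s t.
Proof. by exists (state_at n ((pos s).+1 %% period n)%N false); apply: gedge_state_at. Qed.

Definition mimic_game (n : nat) : game :=
  Game (inr (ord0, false)) (@gedge_total n) (@gweight n).

(** * Energy levels of plays, computed round by round *)

Lemma EL_play_prefix (G : game) (pi : nat -> state G) N :
  EL (play_prefix pi N) = \sum_(0 <= t < N) weight (pi t) (pi t.+1).
Proof.
rewrite /EL /play_prefix.
have -> : zip (mkseq pi N.+1) (behead (mkseq pi N.+1)) =
          [seq (pi t, pi t.+1) | t <- iota 0 N].
  rewrite /mkseq /=.
  elim: N 0%N => //= N IH a; by rewrite -IH.
by rewrite big_map /index_iota subn0.
Qed.

Lemma pos_play n (pi : nat -> gstate n) :
  @is_play (mimic_game n) pi -> forall t, pos (pi t) = (t %% period n)%N.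
Proof.
case=> pi0 piE; elim=> [|t IH]; first by rewrite pi0 mod0n.
by rewrite (eqP (piE t)) IH -addn1 modnDml addn1.
Qed.

(** Regroups a round so that the moves of P2 and P1 on the same index [i] stand side by side; the
    idle position [n + 1] contributes nothing. *)
Lemma sum_rounds n (f : nat -> int) q :
  (forall j, f (j * period n + n.+1)%N = 0) ->
  \sum_(0 <= t < q * period n) f t =
  \sum_(0 <= j < q) \sum_(i < n.+1)
    (f (j * period n + i)%N + f (j * period n + (n.+2 + i))%N).
Proof.
move=> f0; elim: q => [|q IH]; first by rewrite !big_geq.
rewrite [RHS]big_nat_recr //= -IH mulSn addnC.
rewrite (big_cat_nat (n := q * period n)) //= ?leq_addr //; congr (_ + _).
rewrite -{1}[(q * period n)%N]add0n big_addn addKn.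
under eq_bigr do rewrite addnC.
(* The last round splits into the [n + 2] positions of P2, whose last one is idle, and the [n + 1]
   positions of P1. *)
rewrite big_mkord /period big_split_ord /= big_ord_recr /= f0 addr0.
by rewrite -big_split.
Qed.

Lemma modn_round n j i : (i < period n)%N -> ((j * period n + i) %% period n = i)%N.
Proof. by move=> h; rewrite modnMDl modn_small. Qed.

Lemma half_lt n (c : 'I_(2 * n.+1)) : (c./2 < n.+1)%N.
Proof. by have := ltn_ord c; lia. Qed.

Lemma weight_play n (pi : nat -> gstate n) (c : 'I_(2 * n.+1)) j i :
  @is_play (mimic_game n) pi -> (i < period n)%N ->
  gweight (pi (j * period n + i)%N) (pi (j * period n + i).+1) 0 c =
  if c./2 == (if (i < n.+2)%N then i else (i - n.+2)%N)
  then (-1) ^+ (odd c (+) bit (pi (j * period n + i).+1)) else 0.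
Proof. by move=> piP lti; rewrite mxE coordE pos_play // modn_round. Qed.

Lemma weight_idle n (pi : nat -> gstate n) (c : 'I_(2 * n.+1)) j :
  @is_play (mimic_game n) pi ->
  gweight (pi (j * period n + n.+1)%N) (pi (j * period n + n.+1).+1) 0 c = 0.
Proof.
move=> piP; rewrite weight_play //; last by rewrite /period; lia.
by rewrite ltnSn; case: eqP => // h; have := ltn_ord c; lia.
Qed.

(** In each round only two moves touch dimension [c]: those of P2 and of P1 on index [c./2]. The
    successor in the time index appears because a bit is stored in the target of its move. *)
Lemma sum_dim n (pi : nat -> gstate n) (c : 'I_(2 * n.+1)) q :
  @is_play (mimic_game n) pi ->
  \sum_(0 <= t < q * period n) gweight (pi t) (pi t.+1) 0 c =
  \sum_(0 <= j < q)
    ((-1) ^+ (odd c (+) bit (pi (j * period n + c./2).+1)) +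
     (-1) ^+ (odd c (+) bit (pi (j * period n + (n.+2 + c./2)).+1))).
Proof.
move=> piP; have ltc := half_lt c.
rewrite (@sum_rounds n (fun t => gweight (pi t) (pi t.+1) 0 c)) => [|j]; last first.
  exact: weight_idle.
apply: eq_bigr => j _; rewrite (bigD1 (Ordinal ltc)) //= big1 => [|i neq_ic].
  rewrite addr0 !weight_play //; try by rewrite /period; lia.
  by rewrite addKn [(n.+2 + _ < _)%N]ltnNge leq_addr /= eqxx (leq_trans ltc) //= eqxx.
have lti := ltn_ord i; have ne : (c./2 == i) = false by apply: contraNF neq_ic => /eqP e; apply/eqP/val_inj.
rewrite !weight_play //; try by rewrite /period; lia.
by rewrite addKn [(n.+2 + _ < _)%N]ltnNge leq_addr /= (leq_trans lti) // ne.
Qed.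

Lemma gweight_values n (s t : gstate n) (c : 'I_(2 * n.+1)) :
  gweight s t 0 c \in [:: -1; 0; 1 : int].
Proof. by rewrite mxE; case: ifP => // _; case: (_ (+) _). Qed.

Lemma absz_gweight n (s t : gstate n) (c : 'I_(2 * n.+1)) : (`|gweight s t 0%R c| <= 1)%N.
Proof. by have := gweight_values s t c; rewrite !inE => /or3P[] /eqP ->. Qed.

(** * A winning strategy for P1 *)

(* P1 answers in each round with the complement of P2's bits. *)
Definition mimic (n : nat) (h : seq (gstate n)) : gstate n :=
  let s := last (inr (ord0, false)) h in
  state_at n ((pos s).+1 %% period n)%N
    (~~ bit (nth (inr (ord0, false)) h (size h - n.+2))).

(** Each full round sums to zero in every dimension, and an unfinished round has fewer than
    [period n] moves, each costing at most 1; hence the credit [period n]. *)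
Lemma mimic_winning n :
  @winning (mimic_game n) (const_mx (period n)) (@mimic n).
Proof.
split=> [h s _|pi piP con N c].
  by have := @gedge_state_at n (inl s); rewrite /mimic last_rcons; apply.
rewrite EL_play_prefix summxE.
have resp j i : (i < n.+1)%N -> bit (pi (j * period n + (n.+2 + i)).+1) =
    ~~ bit (pi (j * period n + i).+1).
  move=> lti; set t := (j * period n + (n.+2 + i))%N.
  have pt : pos (pi t) = (n.+2 + i)%N.
    by rewrite pos_play // modn_round // /period; lia.
  case e : (pi t) => [x|[y b]]; last first.
    by move: pt; rewrite e /=; have := ltn_ord y; lia.
  (* The prefix has length [t + 1], so [mimic] reads index [t + 1 - (n + 2)], which is
     [j * period n + i + 1]: the target of P2's [i]-th move. *)
  rewrite (con _ _ e) /mimic bit_state_at /play_prefix size_mkseq nth_mkseq; last by lia.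
  by congr (~~ bit (pi _)); rewrite /t; lia.
pose f t : int := gweight (pi t) (pi t.+1) 0 c.
have full q : \sum_(0 <= t < q * period n) f t = 0.
  rewrite sum_dim // big1 // => j _; rewrite resp; last exact: half_lt.
  by rewrite addbN; case: (_ (+) _).
rewrite mxE; change (0 <= (period n)%:Z + \sum_(0 <= t < N) f t).
rewrite (divn_eq N (period n)) (big_cat_nat (n := (N %/ period n * period n)%N)) ?leq_addr //=.
rewrite full add0r -lerBlDl sub0r.
have lo : \sum_(N %/ period n * period n <= t < N %/ period n * period n + N %% period n)
    (-1 : int) <= \sum_(N %/ period n * period n <= t < N %/ period n * period n + N %% period n) f t.
  by apply: ler_sum => t _; rewrite /f; have := absz_gweight (pi t) (pi t.+1) c; lia.
apply: le_trans lo; rewrite sumr_const_nat addKn.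
by have := ltn_pmod N (period_gt0 n); lia.
Qed.

(** * The play in which P2 repeats the same bits [u] in every round *)

Section LowerBound.
Variables (n : nat) (A : moore (mimic_game n)).

Definition reply_step (x : memory A * gstate n) : memory A * gstate n :=
  (alpha_u x.1 x.2, if x.2 is inl s then alpha_n x.1 s else x.2).

(** A function of the memory alone, with fixed start state and no [u], so it takes at most
    [#|memory A|] values. Bit [i] is read after [i + 1] steps, in the target of the move. *)
Definition reply (m : memory A) : {ffun 'I_n.+1 -> bool} :=
  [ffun i : 'I_n.+1 => bit (iter i.+1 reply_step (m, inl (ord0, false))).2].

Variable u : {ffun 'I_n.+1 -> bool}.

(* On the idle move P2 always plays false, so that P1's first state of a round
   carries no information about u. *)
Definition play_step (x : memory A * gstate n) : memory A * gstate n :=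
  (alpha_u x.1 x.2,
   match x.2 with
   | inl s => alpha_n x.1 s
   | inr s => state_at n s.1.+1 ((s.1 < n.+1)%N && u (inord s.1))
   end).

Definition play_run t := iter t play_step (m0 A, inr (ord0, false)).

Definition constant_play t : state (mimic_game n) := (play_run t).2.

Lemma constant_playS t : constant_play t.+1 =
  match constant_play t with
  | inl s => alpha_n (play_run t).1 s
  | inr s => state_at n s.1.+1 ((s.1 < n.+1)%N && u (inord s.1))
  end.
Proof. by []. Qed.

Lemma memory_run t :
  (play_run t).1 = foldl (@alpha_u _ A) (m0 A) (mkseq constant_play t).
Proof.
elim: t => // t IH.
by rewrite /mkseq -addn1 iotaD map_cat foldl_cat -/(mkseq _ _) /= -IH addn1 /=.
Qed.

(** [encodes] and [is_strategy] constrain moves only after genuine prefixes, so legality is proved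
    by induction on time: a valid prefix makes the next move an edge, which extends the prefix. *)
Lemma constant_playP sigma :
  is_strategy sigma -> encodes A sigma ->
  @is_play (mimic_game n) constant_play /\
  @consistent (mimic_game n) sigma constant_play.
Proof.
move=> strat enc.
have prefixS t : play_prefix (G := mimic_game n) constant_play t =
    rcons (mkseq constant_play t) (constant_play t).
  by rewrite /play_prefix /mkseq -addn1 iotaD map_cat cats1 add0n.
have nextE t s : @is_prefix (mimic_game n) (play_prefix (G := mimic_game n) constant_play t) ->
    constant_play t = inl s ->
    constant_play t.+1 = sigma (play_prefix (G := mimic_game n) constant_play t).
  rewrite prefixS => pre e; move: pre; rewrite e => /enc ->.
  by rewrite -memory_run constant_playS e.
have edgeP t : @is_prefix (mimic_game n) (play_prefix (G := mimic_game n) constant_play t) ->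
    gedge (constant_play t) (constant_play t.+1).
  move=> pre; case e : (constant_play t) => [s|s].
    rewrite (nextE _ _ pre e); move: pre; rewrite prefixS e => pre.
    exact: (strat _ _ pre).
  rewrite constant_playS e.
  have lts : (s.1.+1 < period n)%N by rewrite /period; have := ltn_ord s.1; lia.
  by rewrite /gedge pos_state_at //= modn_small.
have pre t : @is_prefix (mimic_game n) (play_prefix (G := mimic_game n) constant_play t).
  elim: t => [|t IH]; first by [].
  have := edgeP t IH; move: IH.
  rewrite [play_prefix _ t.+1]prefixS /play_prefix /mkseq /= => pth e.
  rewrite rcons_path pth (last_map constant_play _ 0%N).
  by rewrite (last_nth 0%N) size_iota -[0%N :: _]/(iota 0 t.+1) nth_iota.
split; first by split=> // t; apply: edgeP.
by move=> t s e; apply: nextE e.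
Qed.

Hypothesis playP : @is_play (mimic_game n) constant_play.

Lemma constant_play_bit j i : (i < n.+2)%N ->
  bit (constant_play (j * period n + i).+1) = (i < n.+1)%N && u (inord i).
Proof.
move=> lti; have lti' : (i < period n)%N by apply: leq_trans lti _; apply: leq_addr.
have := pos_play playP (j * period n + i); rewrite modn_round // constant_playS.
by case: constant_play => s /= e; rewrite ?bit_state_at -?e //; move: lti; rewrite -e; lia.
Qed.

(** At time [T] the state is [inl (ord0, false)] whatever [u] is, and during P1's [n + 1] moves
    [play_step] and [reply_step] coincide. *)
Lemma constant_play_reply j (i : 'I_n.+1) :
  bit (constant_play (j * period n + (n.+2 + i)).+1) =
  reply (play_run (j * period n + n.+2)).1 i.
Proof.
set T := (j * period n + n.+2)%N.
have posT k : (k < n.+1)%N -> pos (constant_play (T + k)) = (n.+2 + k)%N.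
  by move=> ltk; rewrite pos_play // -addnA modn_round // /period; lia.
have runT : play_run T = ((play_run T).1, inl (ord0, false)).
  rewrite [LHS]surjective_pairing; congr (_, _).
  have pT : pos (constant_play T) = n.+2 by rewrite -[T]addn0 posT ?addn0.
  (* The move into time [T] is the idle one, whose bit is false. *)
  have bT : bit (constant_play T) = false.
    by rewrite /T addnS constant_play_bit ?ltnn.
  rewrite -/(constant_play T) -(state_atK (constant_play T)) pT bT.
  rewrite /state_at ltnn subnn; congr (inl (_, _)).
  by apply: val_inj; rewrite /= inordK.
have run k : (k <= n.+1)%N ->
    play_run (T + k) = iter k reply_step ((play_run T).1, inl (ord0, false)).
  elim: k => [_|k IH ltk]; first by rewrite addn0.
  rewrite addnS iterS -IH; last exact: ltnW.
  rewrite [LHS]/= -/(play_run _) /play_step /reply_step; have := posT k ltk.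
  rewrite /constant_play; case: (play_run _).2 => //= s e.
  by have := ltn_ord s.1; lia.
rewrite ffunE -run ?ltn_ord //.
by have -> : (T + i.+1 = (j * period n + (n.+2 + i)).+1)%N by rewrite /T; lia.
Qed.

End LowerBound.

(** * Every answer vector occurs, hence the memory bound *)

Lemma dim_of_subproof n (i : 'I_n.+1) (b : bool) : (b + i.*2 < 2 * n.+1)%N.
Proof. by have := ltn_ord i; case: b; lia. Qed.

Definition dim_of n (i : 'I_n.+1) (b : bool) : 'I_(2 * n.+1) :=
  Ordinal (dim_of_subproof i b).

(** The coordinate where the answer agrees with [u] may change from round to round, so the energies
    are summed over all [i] instead of being followed in one dimension. *)
Lemma reply_onto n (A : moore (mimic_game n)) v0 sigma (r : {ffun 'I_n.+1 -> bool}) :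
  @winning (mimic_game n) v0 sigma -> encodes A sigma ->
  exists m : memory A, reply m = r.
Proof.
move=> [strat win] enc; pose u := [ffun i => ~~ r i].
case: (boolP [exists m : memory A, reply m == r]) => [/existsP[m /eqP]|]; first by exists m.
rewrite negb_exists => /forallP miss.
have agree (m : memory A) : exists i, reply m i = u i.
  have : ~~ [forall i, reply m i == r i].
    by apply: contra (miss m) => /forallP h; apply/eqP/ffunP => i; apply/eqP.
  by rewrite negb_forall => /existsP[i h]; exists i; rewrite [RHS]ffunE;
     case: (r i) h; case: (reply m i).
have [playP con] := constant_playP u strat enc.
(* The dimension of pair [i] that the bit [u i] decreases. *)
pose c i := dim_of i (~~ u i).
(* One round more than the total credit of these dimensions: losing at least 1 per round then makes
   the total negative. *)
pose q := (\sum_i v0 0%R (c i)).+1.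
have nonneg i := win _ playP con (q * period n)%N (c i).
exfalso; have : 0 <= \sum_i ((v0 0 (c i))%:Z +
  EL (play_prefix (G := mimic_game n) (constant_play A u) (q * period n)) 0 (c i)).
  by apply: sumr_ge0 => i _; apply: nonneg.
apply/negP; rewrite -ltNge big_split /=.
pose m j := (play_run A u (j * period n + n.+2)).1.
(* The [-1] is P2's move, the other term P1's: -2 if the answer agrees with [u] at [i], otherwise
   0. *)
pose d j i : int := -1 + (-1) ^+ (~~ u i (+) reply (m j) i).
have ELE i : EL (play_prefix (G := mimic_game n) (constant_play A u) (q * period n)) 0 (c i) =
    \sum_(0 <= j < q) d j i.
  rewrite EL_play_prefix summxE [LHS](sum_dim _ _ playP).
  apply: eq_bigr => j _.
  have -> : (c i)./2 = i by rewrite /= half_bit_double.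
  have -> : odd (c i) = ~~ u i by rewrite /= oddD odd_double addbF oddb.
  rewrite constant_play_bit ?constant_play_reply // ?ltn_ord; last exact: leqW (ltn_ord i).
  by rewrite inord_val andTb addNb addbb.
under [X in _ + X]eq_bigr do rewrite ELE.
rewrite exchange_big /=.
have d_le0 j i : d j i <= 0 by rewrite /d; case: (_ (+) _).
have round j : \sum_i d j i <= -1.
  have [i eq_i] := agree (m j); rewrite (bigD1 i) //=.
  have -> : d j i = -2 by rewrite /d eq_i addNb addbb.
  have rest : \sum_(k | k != i) d j k <= 0 by apply: sumr_le0 => k _; apply: d_le0.
  exact: le_trans (lerD (lexx _) rest) _.
have : \sum_(0 <= j < q) \sum_i d j i <= \sum_(0 <= j < q) -1.
  by apply: ler_sum => j _; apply: round.
rewrite sumr_const_nat subn0.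
have -> : \sum_i (v0 0 (c i))%:Z = (q.-1)%:Z by rewrite (big_morph Posz PoszD (erefl _)).
move=> le_d; apply: le_lt_trans (lerD (lexx _) le_d) _; rewrite /q; lia.
Qed.

Lemma memory_lower_bound n (A : moore (mimic_game n)) v0 sigma :
  @winning (mimic_game n) v0 sigma -> encodes A sigma ->
  (2 ^ n.+1 <= #|memory A|)%N.
Proof.
move=> win enc; have onto r := reply_onto r win enc.
have -> : (2 ^ n.+1 = #|{ffun 'I_n.+1 -> bool}|)%N by rewrite card_ffun card_bool card_ord.
apply: leq_trans (leq_image_card (@reply n A) _); apply/subset_leq_card/subsetP => r _.
by have [m <-] := onto r; apply: codom_f.
Qed.

(** * Polynomial size and conclusion *)

Lemma mimic_game_size n :
  (game_size (mimic_game n) <= 4 * n + 6 + (4 * n + 6) ^ 2 * (1 + 2 * n.+1 * 2))%N.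
Proof.
have card_states : #|state (mimic_game n)| = (4 * n + 6)%N.
  by rewrite card_sum !card_prod !card_ord card_bool; lia.
rewrite /game_size card_states leq_add2l.
(* The edges are bounded by all ordered pairs of states. *)
have -> : ((4 * n + 6) ^ 2 = #|{: state (mimic_game n) * state (mimic_game n)}|)%N.
  by rewrite card_prod card_states -mulnn.
rewrite -sum_nat_const.
rewrite big_mkcond; apply: leq_sum => e _; case: ifP => // _.
rewrite leq_add2l.
(* A weight of absolute value at most 1 takes one digit and a sign. *)
apply: (@leq_trans (\sum_(i < 2 * n.+1) 2)); last by rewrite sum_nat_const card_ord.
apply: leq_sum => i _; have := absz_gweight e.1 e.2 i.
by rewrite /=; case: absz => [|[|]].
Qed.

Theorem lemma8 (R : realType) :
  exists G : nat -> game,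
    [/\ forall K : nat, (1 <= K)%N -> game_dim (G K) = (2 * K)%N,
        forall K : nat, (1 <= K)%N -> forall (s t : state (G K)), edge s t ->
          forall i : 'I_(game_dim (G K)), weight s t 0 i \in [:: -1; 0; 1 : int],
        exists p : {poly nat}, forall K : nat, (1 <= K)%N ->
          (game_size (G K) <= p.[K])%N,
        forall K : nat, (1 <= K)%N ->
          exists (v0 : 'rV[nat]_(game_dim (G K)))
                 (sigma : seq (state (G K)) -> state (G K)), winning v0 sigma
      & exists a : R, 0 < a /\
          forall K : nat, (1 <= K)%N ->
          forall (v0 : 'rV[nat]_(game_dim (G K)))
                 (sigma : seq (state (G K)) -> state (G K)),
            winning v0 sigma ->
          forall A : moore (G K), encodes A sigma ->
            2 `^ (a * (game_dim (G K))%:R) <= #|memory A|%:R].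
Proof.
exists (fun K => mimic_game K.-1); split.
- by case.
- by move=> [|n] // _ s t _ i; apply: gweight_values.
(* [S] is the number of states, [4 * n + 6], rewritten in [K = n + 1]. *)
- pose S : {poly nat} := 4%N%:P * 'X + 2%N%:P.
  exists (S + S * S * (1%N%:P + 4%N%:P * 'X)) => -[|n] // _.
  have -> : (S + S * S * (1%N%:P + 4%N%:P * 'X)).[n.+1] =
      (4 * n.+1 + 2 + (4 * n.+1 + 2) * (4 * n.+1 + 2) * (1 + 4 * n.+1))%N.
    by rewrite !(hornerD, hornerM, hornerC, hornerX).
  by apply: leq_trans (mimic_game_size n) _; rewrite -mulnn; apply: eq_leq; lia.
- by move=> [|n] // _; exists (const_mx (period n)), (@mimic n); apply: mimic_winning.
(* The dimension is [2 * K], so the exponent becomes [K]. *)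
exists (2^-1); split=> [|[|n] // _ v0 sigma win A enc]; first by rewrite invr_gt0.
rewrite /= natrM mulKf ?pnatr_eq0 // powR_mulrn // -natrX ler_nat.
exact: memory_lower_bound win enc.
Qed.
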